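(* Let $(q_n)$ and $(a_{n,i})$ be the cutting and spacer parameters for a rank-one transformation $T$ and suppose the cutting parameter $(q_n)$ is bounded. Then $T$ is totally ergodic if and only if for every integer $d>1$ and every $N\in\mathbb{N}$ there are $n\ge N$ and $0<i<q_n$ such that $d$ does not divide $h_N+a_{n,i}$, where $h_0=1$ and $h_{n+1}=q_nh_n+\sum_{0<i<q_n}a_{n,i}$.
   Context: $\mathbb{N}=\{0,1,2,\dots\}$. **Rank-one transformations.** Let $q_n>1$ ($n\in\mathbb{N}$) be integers and $a_{n,i}\ge 0$ ($n\in\mathbb{N}$, $0<i<q_n$) integers, and $h_0=1$, $h_{n+1}=q_nh_n+\sum_{0<i<q_n}a_{n,i}$. An invertible measure preserving transformation $T$ of $[0,1]$ with Lebesgue measure is rank-one with cutting parameter $(q_n)$ and spacer parameter $(a_{n,i})$ if $\sum_n (h_{n+1}-q_nh_n)/h_{n+1}<\infty$ and there are measurable sets $B_n$, $B_{n,i}$ ($0<i\le q_n$), $C_{n,i,j}$ ($0<i<q_n$, $0<j\le a_{n,i}$) such that for all $n$: $\{B_{n,i}:0<i\le q_n\}$ is a partition of $B_n$; the sets $T^k(B_n)$, $0\le k<h_n$, are disjoint; for $0<i<q_n$, $T^{h_n}(B_{n,i})=C_{n,i,1}$ if $a_{n,i}\ne0$ and $T^{h_n}(B_{n,i})=B_{n,i+1}$ if $a_{n,i}=0$; $T(C_{n,i,j})=C_{n,i,j+1}$ if $j<a_{n,i}$; $T(C_{n,i,a_{n,i}})=B_{n,i+1}$ if $i<q_n$ and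 $a_{n,i}\neq 0$; $B_{n+1}=B_{n,1}$; and the finite unions of levels $T^k(B_n)$ ($n\in\mathbb{N}$, $0\le k<h_n$) are dense in the measure algebra. A measure preserving transformation of a Lebesgue space is rank-one, described by these parameters, if it is isomorphic to such a $T$. $T$ is totally ergodic if $T^k$ is ergodic for every positive integer $k$. *)

(* Defs.v *)
From mathcomp Require Import all_boot all_order all_algebra.
From mathcomp Require Import all_classical all_reals all_analysis.

Set Implicit Arguments.
Unset Strict Implicit.
Unset Printing Implicit Defensive.
Import Order.TTheory GRing.Theory Num.Theory.
Import numFieldNormedType.Exports.

Local Open Scope classical_set_scope.
Local Open Scope ring_scope.

(* A measure space is given by a carrier set [D] in a measurable type together
   with a measure [mu] on that type; maps are total functions whose values
   outside [D] are irrelevant. The carrier is [`[0, 1]] for the unit interval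
   and [setT] for a probability space. *)
Section transformations.
Context {d : measure_display} {X : measurableType d} {R : realType}.
Variables (mu : set X -> \bar R) (D : set X) (T : X -> X).

Definition measure_preserving : Prop :=
  set_fun D D T /\
  forall A, measurable A -> A `<=` D ->
    measurable (D `&` T @^-1` A) /\ mu (D `&` T @^-1` A) = mu A.

Definition invertible_measure_preserving : Prop :=
  [/\ set_bij D D T, measure_preserving
    & forall A, measurable A -> A `<=` D -> measurable (T @` A)].

End transformations.

Section ergodicity.
Context {d : measure_display} {X : measurableType d} {R : realType}.
Variable P : probability X R.

Definition ergodic (T : X -> X) : Prop :=
  forall A, measurable A -> T @^-1` A = A -> P A = 0%E \/ P A = 1%E.

Definition totally_ergodic (T : X -> X) : Prop :=
  forall k, (0 < k)%N -> ergodic (iter k T).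

End ergodicity.

(* [A] is measurable for the completion of [mu], where it has measure [m]. *)
Definition has_completed_measure {d} {X : measurableType d} {R : realType}
    (mu : set X -> \bar R) (A : set X) (m : \bar R) : Prop :=
  exists B, [/\ measurable B, mu.-negligible (A `+` B) & mu B = m].

(* Isomorphism modulo null sets. Measurability is understood for the
   completions, so that it does not matter whether the sigma-algebra of a
   Lebesgue space is taken to be the Borel one or its completion. *)
Definition isomorphic {d d'} {X : measurableType d} {Y : measurableType d'}
    {R : realType}
    (mu : set X -> \bar R) (D : set X) (T : X -> X)
    (nu : set Y -> \bar R) (E : set Y) (S : Y -> Y) : Prop :=
  exists (X0 : set X) (Y0 : set Y) (phi : X -> Y),
    [/\ [/\ X0 `<=` D, mu.-negligible (D `\` X0) & set_fun X0 X0 T],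
        [/\ Y0 `<=` E, nu.-negligible (E `\` Y0) & set_fun Y0 Y0 S],
        set_bij X0 Y0 phi,
        (forall A m, A `<=` X0 ->
           has_completed_measure mu A m <->
           has_completed_measure nu (phi @` A) m)
      & forall x, X0 x -> phi (T x) = S (phi x)].

Section rank_one.
Variables (q : nat -> nat) (a : nat -> nat -> nat).

Fixpoint height (n : nat) : nat :=
  if n is m.+1 then (q m * height m + \sum_(1 <= i < q m) a m i)%N else 1%N.

Section on_measure_space.
Context {d : measure_display} {X : measurableType d} {R : realType}.
Variables (mu : set X -> \bar R) (D : set X) (T : X -> X).

Let T_ (k : nat) (A : set X) : set X := iter k T @` A.

(* [B n] is the base of the [n]-th tower, [Bs n i] its [i]-th subbase, and
   [C n i j] the [j]-th spacer above the column over [Bs n i]. *)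
Record rank_one_sets (B : nat -> set X) (Bs : nat -> nat -> set X)
    (C : nat -> nat -> nat -> set X) : Prop := RankOneSets {
  base_meas : forall n, measurable (B n) /\ B n `<=` D ;
  subbase_meas : forall n i, (0 < i <= q n)%N ->
    measurable (Bs n i) /\ Bs n i `<=` D ;
  spacer_meas : forall n i j, (0 < i < q n)%N -> (0 < j <= a n i)%N ->
    measurable (C n i j) /\ C n i j `<=` D ;
  subbase_partition : forall n,
    partition [set i | (0 < i <= q n)%N] (Bs n) (B n) ;
  levels_disjoint : forall n, trivIset `I_(height n) (fun k => T_ k (B n)) ;
  column_to_spacer : forall n i, (0 < i < q n)%N -> a n i <> 0%N ->
    T_ (height n) (Bs n i) = C n i 1%N ;
  column_to_column : forall n i, (0 < i < q n)%N -> a n i = 0%N ->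
    T_ (height n) (Bs n i) = Bs n i.+1 ;
  spacer_to_spacer : forall n i j, (0 < i < q n)%N -> (0 < j < a n i)%N ->
    T @` C n i j = C n i j.+1 ;
  spacer_to_column : forall n i, (0 < i < q n)%N -> a n i <> 0%N ->
    T @` C n i (a n i) = Bs n i.+1 ;
  next_base : forall n, B n.+1 = Bs n 1%N ;
  levels_dense : forall A (e : R), measurable A -> A `<=` D -> 0 < e ->
    exists s : seq (nat * nat),
      (forall p, p \in s -> (p.2 < height p.1)%N) /\
      (mu (A `+` \bigcup_(p in [set` s]) T_ p.2 (B p.1)) < e%:E)%E
}.

Definition rank_one_on : Prop :=
  [/\ forall n, (1 < q n)%N,
      invertible_measure_preserving mu D T,
      (\sum_(0 <= n <oo)
         (((height n.+1)%:R - (q n * height n)%N%:R) / (height n.+1)%:R : R)%:E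
         < +oo)%E
    & exists B Bs C, rank_one_sets B Bs C].

End on_measure_space.

(* [completed_lebesgue_measure] lives on the sigma-algebra of Lebesgue
   measurable sets, whose underlying type is convertible to [R]. *)
Definition rank_one_interval {R : realType} (S : R -> R) : Prop :=
  rank_one_on (@completed_lebesgue_measure R) (`[0, 1] : set R) S.

Definition rank_one {d : measure_display} {X : measurableType d}
    {R : realType} (P : probability X R) (T : X -> X) : Prop :=
  measure_preserving P setT T /\
  exists S : R -> R, rank_one_interval S /\
    isomorphic P setT T (@completed_lebesgue_measure R) (`[0, 1] : set R) S.

End rank_one.

(* Main.v *)
Require Import Defs.
From HB Require Import structures.
From mathcomp Require Import all_boot all_order all_algebra.
From mathcomp Require Import all_classical all_reals all_analysis.
From mathcomp Require Import lra.

Set Implicit Arguments.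
Unset Strict Implicit.
Unset Printing Implicit Defensive.
Import Order.TTheory GRing.Theory Num.Theory.
Import numFieldNormedType.Exports.

Local Open Scope classical_set_scope.
Local Open Scope ring_scope.

(** The cuts make the levels of each tower unions of levels of every later
tower, so the unions of levels of a single tower that comes late enough
already approximate all measurable sets. Hence for every set [E] of positive
measure and every [eps], each late tower [n] has a level that lies in [E] up to
a proportion [eps] of itself ([level_nearly_inside]). Everything about the
transformation [S] is read off from this and from the return times
[height n + a n i] between consecutive columns of tower [n].

Suppose that the arithmetic condition holds and that [A] is invariant under
the [k]-th iterate. The sequence of truth values of [A] along an orbit has
period [k], so only finitely many sequences occur and one of them, [w], occurs
on a set [E] of positive measure. As the numbers of cuts are bounded, the
proportion of [E] in a suitable level of tower [n] remains above one half on
each of the pieces into which the level is cut. Consecutive pieces are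
[height n + a n i] steps apart, so some point of [E] returns to [E] after this
time ([return_in_column]), and therefore [height n + a n i] is a period of [w].
Let [e] be the least period of [w], which divides all the others. If [1 < e],
then [e] divides [height n + a n i] for all large [n]; this makes the heights
constant modulo [e] and contradicts the condition. So [w] is constant. Since
two sets of positive measure are always visited by a common orbit
([common_orbit]), [A] or its complement is null.

Conversely, if [k] divides [height N + a n i] for all [n >= N], then the heights
are constant modulo [k] from [N] on, and in every later tower the copies of the
base [B N] sit at multiples of [k]. Almost all returns to [B N] thus take a
multiple of [k] steps ([base_return_null]; the exceptions pass through the top
of every tower). The set of points that enter [B N] in a multiple of [k] steps
is invariant modulo null sets under the [k]-th iterate and has positive
measure, but its preimage under [S] meets [B N] in a null set.

Both arguments are carried out for a globally injective map of a probability
space, obtained by extending the interval map by the identity off the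
interval. Ergodicity is transported through the isomorphism in the form that
quantifies over sets invariant modulo null sets, because the isomorphism only
respects sets up to null sets ([ergodic_mod0P], [isomorphic_ergodic_mod0]). *)

(** * Real-valued probabilities *)

Section measure_facts.
Context {d : measure_display} {X : measurableType d} {R : realType}.
Variable P : probability X R.
Local Notation m A := (fine (P A)).

Lemma prob_fineK A : measurable A -> (m A)%:E = P A.
Proof. by move=> mA; rewrite fineK// fin_num_measure. Qed.

Lemma fine_prob_ge0 A : 0 <= m A.
Proof. by rewrite fine_ge0. Qed.

Lemma le_fine_prob A B : measurable A -> measurable B -> A `<=` B -> m A <= m B.
Proof.
move=> mA mB AB; rewrite -lee_fin !prob_fineK//.
by apply: le_measure; rewrite ?inE.
Qed.

Lemma fine_probD A B : measurable A -> measurable B ->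
  m A = m (A `&` B) + m (A `\` B).
Proof.
move=> mA mB; have mI := measurableI _ _ mA mB; have mD := measurableD mA mB.
apply/EFin_inj; rewrite EFinD !prob_fineK// -measureU//.
  by rewrite setUIDK.
by rewrite setDE setIACA setICr setI0.
Qed.

Lemma prob_eq0 A : measurable A -> P A = 0%E <-> m A = 0.
Proof.
by move=> mA; split=> [->//|mA0]; rewrite -prob_fineK// mA0.
Qed.

Lemma fine_prob_sub_bigcup (A : set X) (F : nat -> set X) (k : nat) (c : R) :
  measurable A -> (forall i, measurable (F i)) -> (forall i, m (F i) = c) ->
  A `<=` \bigcup_(i < k) F i -> m A <= k%:R * c.
Proof.
move=> mA mF Fc; rewrite bigcup_mkord => AF.
rewrite -lee_fin prob_fineK//.
apply: (le_trans (@content_subadditive _ _ _ P _ _ _ (fun i _ => mF i) mA AF)).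
rewrite (eq_bigr (fun=> c%:E)); last first.
  by move=> i _; rewrite -(Fc i); exact/esym/prob_fineK.
by rewrite sumEFin sumr_const card_ord mulr_natl.
Qed.

Lemma fine_prob_leU A B C : measurable A -> measurable B -> measurable C ->
  A `<=` B `|` C -> m A <= m B + m C.
Proof.
move=> mA mB mC ABC; rewrite (fine_probD mA mB) lerD//.
  by apply: le_fine_prob => //; exact: measurableI.
apply: le_fine_prob => //; first exact: measurableD.
by move=> x [/ABC[]].
Qed.

End measure_facts.

(** * Iterates *)

Section iterates.
Context {T : Type} (f : T -> T).

Lemma image_iterD k l A : iter (k + l) f @` A = iter k f @` (iter l f @` A).
Proof.
by rewrite image_comp; apply: eq_imagel => x _ /=; rewrite iterD.
Qed.

Lemma injective_iter k : injective f -> injective (iter k f).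
Proof. by move=> fi; elim: k => // k IH x y /= /fi/IH. Qed.

End iterates.

(** * Ergodicity and sets invariant modulo null sets *)

Section ergodicity_mod0.
Context {d : measure_display} {X : measurableType d} {R : realType}.
Variable P : probability X R.

Definition ergodic_mod0 (f : X -> X) : Prop :=
  forall A, measurable A -> P (A `+` f @^-1` A) = 0%E ->
    P A = 0%E \/ P A = 1%E.

Variable f : X -> X.
Hypothesis mf : forall A, measurable A -> measurable (f @^-1` A).
Hypothesis pf : forall A, measurable A -> P (f @^-1` A) = P A.

Lemma measurable_preimage_iter k A :
  measurable A -> measurable (iter k f @^-1` A).
Proof. by elim: k A => // k IH A /mf/IH. Qed.

Lemma measure_preimage_iter k A : measurable A -> P (iter k f @^-1` A) = P A.
Proof.
elim: k A => // k IH A mA.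
have -> : iter k.+1 f @^-1` A = iter k f @^-1` (f @^-1` A) by [].
by rewrite IH ?pf//; exact: mf.
Qed.

Lemma negligible_preimage A : P.-negligible A -> P.-negligible (f @^-1` A).
Proof.
move=> [N [mN N0 AN]]; exists (f @^-1` N); split; first exact: mf.
  by rewrite pf.
by move=> x /AN.
Qed.

Lemma negligible_iter_preimage k A :
  P.-negligible A -> P.-negligible (iter k f @^-1` A).
Proof. by elim: k A => // k IH A /negligible_preimage/IH. Qed.

Lemma eq_measure_negligible A C : measurable A -> measurable C ->
  P.-negligible (A `+` C) -> P A = P C.
Proof.
move=> mA mC AC; rewrite -(@measureU0 _ _ _ P A (C `\` A))//; last 2 first.
- exact: measurableD.
- apply/negligibleP; first exact: measurableD.
  by apply: negligibleS AC => x; right.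
rewrite -[RHS](@measureU0 _ _ _ P C (A `\` C))//; last 2 first.
- exact: measurableD.
- apply/negligibleP; first exact: measurableD.
  by apply: negligibleS AC => x; left.
by rewrite !setUDr !setDv !setD0 setUC.
Qed.

(** A set invariant modulo null sets agrees, up to a null set, with the set [L]
of points whose orbit visits it infinitely often, and [L] is strictly
invariant. *)
Lemma ergodic_mod0P : ergodic P f <-> ergodic_mod0 f.
Proof.
split=> ergf A mA; last first.
  by move=> fA; apply: ergf => //; rewrite fA setYK measure0.
(* off the null set N, membership in A is constant along orbits *)
move=> fA; pose N := \bigcup_i iter i f @^-1` (A `+` f @^-1` A).
have N0 : P.-negligible N.
  apply: negligible_bigcup => i; apply: negligible_iter_preimage.
  apply/negligibleP => //.
  by apply: measurableU; apply: measurableD => //; exact: mf.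
pose L := \bigcap_n \bigcup_i iter (i + n) f @^-1` A.
have mL : measurable L.
  apply: bigcapT_measurable => n; apply: bigcupT_measurable => i.
  exact: measurable_preimage_iter.
have fL : f @^-1` L = L.
  apply/seteqP; split=> x Lx n _.
    have [i _ Ai] := Lx n Logic.I; exists i.+1 => //.
    by rewrite /preimage addSn /mkset iterSr.
  have [i _ Ai] := Lx n.+1 Logic.I; exists i => //.
  by rewrite /preimage /mkset -iterSr -addnS.
have constA x : ~ N x -> forall i, A (iter i f x) <-> A x.
  move=> Nx; elim=> // i <-; apply: iff_sym; split=> Ai; apply: contrapT => nAi.
    by apply: Nx; exists i => //; left.
  by apply: Nx; exists i => //; right.
have AL : P.-negligible (A `+` L).
  apply: negligibleS N0 => x ALx; apply: contrapT => Nx.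
  case: ALx => -[Ax]; apply.
    by move=> n _; exists 0%N => //=; exact/constA.
  by have [i _ /(constA _ Nx)] := Ax 0%N Logic.I.
have <- : P L = P A by apply/esym/eq_measure_negligible.
exact: ergf.
Qed.

End ergodicity_mod0.

(** * Periods and itineraries *)

Section periods.
Local Open Scope nat_scope.

Definition period (w : nat -> bool) n := forall j, w (j + n) = w j.

Lemma period_mul w n k : period w n -> period w (k * n).
Proof.
move=> wn; elim: k => [|k IH] j; first by rewrite addn0.
by rewrite mulSn addnA IH wn.
Qed.

Lemma least_period w k : 0 < k -> period w k ->
  exists d, [/\ 0 < d, period w d & forall n, period w n -> d %| n].
Proof.
move=> k0 wk; pose isper n := (0 < n) && `[< period w n >].
have exper : exists n, isper n by exists k; rewrite /isper k0; apply/asboolP.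
case: (ex_minnP exper) => d /andP[d0 /asboolP wd] dmin.
exists d; split=> // n wn; rewrite /dvdn.
have [//|r0] := posnP (n %% d).
have : isper (n %% d).
  rewrite /isper r0; apply/asboolP => j.
  by rewrite -(period_mul (n %/ d) wd) -addnA [_ %% _ + _]addnC -divn_eq.
by move=> /dmin; rewrite leqNgt ltn_mod d0.
Qed.

End periods.

Section itineraries.
Context {X : Type} (S : X -> X) (A : set X).

Definition itinerary x (j : nat) := `[< A (iter j S x) >].

Lemma itinerary_iter l x j : itinerary (iter l S x) j = itinerary x (j + l).
Proof. by rewrite /itinerary iterD. Qed.

Lemma itinerary_period k x : iter k S @^-1` A = A -> period (itinerary x) k.
Proof.
move=> kA j; rewrite /itinerary addnC iterD; congr asbool.
by rewrite -[in RHS]kA.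
Qed.

Definition cylinder (w : nat -> bool) := [set x | itinerary x =1 w].

(** A return of a point to a cylinder shifts the common itinerary onto
itself. *)
Lemma return_period w x n : cylinder w x -> cylinder w (iter n S x) ->
  period w n.
Proof. by move=> wx wnx j; rewrite -(wnx j) itinerary_iter wx. Qed.

End itineraries.

(** * Towers *)

Section cutting_and_stacking.
Context {d : measure_display} {X : measurableType d} {R : realType}.
Variables (P : probability X R) (S : X -> X) (q : nat -> nat)
  (a : nat -> nat -> nat).
Local Notation m A := (fine (P A)).
Local Notation height := (height q a).

(** The height, in tower [n.+1], at which the base of column [i] of tower [n]
sits. Columns are numbered from 0 here, whereas the parameters [a n i] start at
[i = 1]: column [i] lies above the spacers counted by [a n 1], ..., [a n i]. *)
Definition offset (n i : nat) : nat :=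
  (\sum_(1 <= j < i.+1) (height n + a n j))%N.

Lemma offset0 n : offset n 0 = 0%N.
Proof. by rewrite /offset big_geq. Qed.

Lemma offsetS n i : offset n i.+1 = (offset n i + (height n + a n i.+1))%N.
Proof. by rewrite /offset big_nat_recr. Qed.

Lemma height_offset n : (0 < q n)%N ->
  height n.+1 = (offset n (q n).-1 + height n)%N.
Proof.
move=> q0; rewrite /offset prednK// big_split/= sum_nat_const_nat addnAC.
by rewrite -mulSnr subn1 prednK.
Qed.

Lemma leq_offset n i j : (i <= j)%N -> (offset n i <= offset n j)%N.
Proof.
move/subnKC <-; elim: (j - i)%N => [|t IH]; first by rewrite addn0.
by rewrite addnS offsetS (leq_trans IH)// leq_addr.
Qed.

Hypothesis q_gt1 : forall n, (1 < q n)%N.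

Lemma height_gt0 n : (0 < height n)%N.
Proof.
elim: n => // n IH /=.
by rewrite addn_gt0 muln_gt0 IH (ltnW (q_gt1 n)).
Qed.

Lemma ltn_height n : (n < height n)%N.
Proof.
elim: n => // n IH; apply: (leq_ltn_trans IH) => /=.
rewrite (@leq_trans (q n * height n)) ?leq_addr//.
by rewrite ltn_Pmull// height_gt0.
Qed.

Lemma offset_level n i l : (l < height n)%N -> (i < q n)%N ->
  (l + offset n i < height n.+1)%N.
Proof.
move=> ln iq; rewrite height_offset ?(leq_ltn_trans _ iq)//.
rewrite addnC -addnS leq_add// leq_offset//.
by rewrite -ltnS prednK// (leq_ltn_trans _ iq).
Qed.

(** The subbases and spacers of a rank-one construction are determined by the
bases and the offsets, so that only the bases [B] remain; the levels of tower
[n] are the images of [B n] under the first [height n] iterates. *)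
Record towers (B : nat -> set X) : Prop := Towers {
  tower_base : forall n, measurable (B n) ;
  tower_cut : forall n,
    B n = \bigcup_(i < q n) iter (offset n i) S @` B n.+1 ;
  tower_disjoint : forall n, trivIset `I_(height n) (fun l => iter l S @` B n) ;
  tower_dense : forall A (e : R), measurable A -> 0 < e ->
    exists s : seq (nat * nat),
      (forall p, p \in s -> (p.2 < height p.1)%N) /\
      (P (A `+` \bigcup_(p in [set` s]) iter p.2 S @` B p.1) < e%:E)%E
}.

(** Images of levels are measurable, and by injectivity they have the measure of
the level; this is how the mass of a tower is spread over its levels. *)
Record automorphism : Prop := Automorphism {
  aut_inj : injective S ;
  aut_preimage : forall A, measurable A -> measurable (S @^-1` A) ;
  aut_image : forall A, measurable A -> measurable (S @` A) ;
  aut_measure : forall A, measurable A -> P (S @^-1` A) = P A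
}.

Hypothesis autS : automorphism.

Lemma measurable_iter_preimage k A :
  measurable A -> measurable (iter k S @^-1` A).
Proof. exact: measurable_preimage_iter (aut_preimage autS) k A. Qed.

Lemma measurable_iter_image k A : measurable A -> measurable (iter k S @` A).
Proof.
elim: k A => [|k IH] A mA; first by rewrite image_id.
by rewrite -addn1 image_iterD; apply: IH; apply: (aut_image autS).
Qed.

Lemma measure_iter_preimage k A : measurable A -> P (iter k S @^-1` A) = P A.
Proof.
exact: measure_preimage_iter (aut_preimage autS) (aut_measure autS) k A.
Qed.

Lemma preimage_iter_image k A : iter k S @^-1` (iter k S @` A) = A.
Proof.
apply/seteqP; split=> [x [y Ay /(injective_iter (aut_inj autS)) <-]//|x Ax].
by exists x.
Qed.

Lemma measure_iter_image k A : measurable A -> P (iter k S @` A) = P A.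
Proof.
move=> mA; rewrite -(measure_iter_preimage k) ?preimage_iter_image//.
exact: measurable_iter_image.
Qed.

Variable B : nat -> set X.
Hypothesis towB : towers B.

Definition level n l := iter l S @` B n.

Lemma measurable_level n l : measurable (level n l).
Proof. exact/measurable_iter_image/(tower_base towB). Qed.

Lemma measure_level n l : P (level n l) = P (B n).
Proof. exact/measure_iter_image/(tower_base towB). Qed.

Lemma level_cut n l :
  level n l = \bigcup_(i < q n) level n.+1 (l + offset n i).
Proof.
rewrite /level {1}(tower_cut towB n) image_bigcup.
by apply: eq_bigcupr => i _; rewrite image_iterD.
Qed.

Lemma sub_level n l i : (i < q n)%N ->
  level n.+1 (l + offset n i) `<=` level n l.
Proof. by move=> iq; rewrite [X in _ `<=` X]level_cut => x; exists i. Qed.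

Lemma level_inj n l l' x : (l < height n)%N -> (l' < height n)%N ->
  level n l x -> level n l' x -> l = l'.
Proof.
by move=> ll ll' lx lx'; apply: (tower_disjoint towB ll ll'); exists x.
Qed.

Lemma base_cut_le n : m (B n) <= (q n)%:R * m (B n.+1).
Proof.
apply: (@fine_prob_sub_bigcup _ _ _ P _ (fun i => level n.+1 (offset n i))).
- exact: (tower_base towB).
- by move=> i; exact: measurable_level.
- by move=> i; rewrite measure_level.
- by rewrite {1}(tower_cut towB n).
Qed.

Lemma height_base_le1 n : (height n)%:R * m (B n) <= 1.
Proof.
have mU : measurable (\bigcup_(l < height n) level n l).
  by apply: bigcup_measurable => l _; exact: measurable_level.
rewrite -lee_fin EFinM (prob_fineK P (tower_base towB n)).
rewrite (le_trans _ (probability_le1 P mU))//.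
rewrite measure_fin_bigcup//=; last 2 first.
- exact: tower_disjoint.
- by move=> l _; exact: measurable_level.
rewrite -fsbig_ord.
rewrite (eq_bigr (fun=> (m (B n))%:E)) => [|i _]; last first.
  rewrite prob_fineK; last exact: (tower_base towB).
  exact: measure_level.
rewrite sumEFin sumr_const card_ord -(prob_fineK P (tower_base towB n)).
by rewrite -EFinM mulr_natl.
Qed.

(** Phrased pointwise, and not with a set of indices, so that passing to a later
tower and to a larger union needs no bookkeeping of indices. *)
Definition tower_union n (U : set X) := forall x, U x ->
  exists l, [/\ (l < height n)%N, level n l x & level n l `<=` U].

Lemma tower_unionS n U : tower_union n U -> tower_union n.+1 U.
Proof.
move=> nU x /nU[l [lh]]; rewrite level_cut => -[i /= iq xi lU].
exists (l + offset n i)%N; split => //; first exact: offset_level.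
by apply: subset_trans lU => y yi; exists i.
Qed.

Lemma tower_union_le n N U : (N <= n)%N -> tower_union N U -> tower_union n U.
Proof.
move=> /subnKC <- NU; elim: (n - N)%N => [|k IH]; first by rewrite addn0.
by rewrite addnS; exact: tower_unionS.
Qed.

Lemma tower_union_levels (s : seq (nat * nat)) :
  (forall p, p \in s -> (p.2 < height p.1)%N) ->
  exists N, forall n, (N <= n)%N ->
    tower_union n (\bigcup_(p in [set` s]) level p.1 p.2).
Proof.
move=> sh; exists (\max_(p <- s) p.1)%N => n leN x [p /= ps px].
have pn : (p.1 <= n)%N.
  by apply: leq_trans leN; apply: (@leq_bigmax_seq _ _ _ fst).
have /(tower_union_le pn)/(_ x px)[l [lh xl lp]] :
    tower_union p.1 (level p.1 p.2).
  by move=> y py; exists p.2; split=> //; exact: sh.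
by exists l; split=> //; apply: subset_trans lp _ => y py; exists p.
Qed.

Lemma tower_union_measureD n U E (eps : R) : 0 <= eps ->
  tower_union n U -> measurable U -> measurable E ->
  (forall l, (l < height n)%N -> eps * m (B n) <= m (level n l `\` E)) ->
  eps * m U <= m (U `\` E).
Proof.
move=> eps0 nU mU mE sparse.
pose J := [set l | (l < height n)%N /\ level n l `<=` U].
have finJ : finite_set J.
  by apply: (@sub_finite_set _ _ `I_(height n)) => // l [].
have UE : U = \bigcup_(l in J) level n l.
  by apply/seteqP; split=> [x /nU[l [lh xl lU]]|x [l [_ lU]] /lU//]; exists l.
have trivJ : trivIset J (level n).
  by move=> i j [ih _] [jh _]; exact: (tower_disjoint towB).
have mlD l : measurable (level n l `\` E).
  by apply: measurableD => //; exact: measurable_level.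
rewrite -lee_fin EFinM !prob_fineK//; last exact: measurableD.
rewrite UE setD_bigcupl !measure_fin_bigcup//=; first last.
- by move=> l _; exact: measurable_level.
- by move=> i j iJ jJ [x [[xi _] [xj _]]]; apply: trivJ => //; exists x.
rewrite ge0_mule_fsumr; last by move=> l; exact: measure_ge0.
apply: lee_fsum => // l [lh _]; rewrite -[leRHS]prob_fineK//.
have -> : P (level n l) = (m (B n))%:E.
  rewrite prob_fineK; first exact: measure_level.
  exact: (tower_base towB).
by rewrite -EFinM lee_fin sparse.
Qed.

(** If every level of tower [n] had a proportion at least [eps] outside [E], so
would every union [U] of levels; but [U] can be chosen close to [E], while
[E] has positive measure. *)
Lemma level_nearly_inside E (eps : R) : measurable E -> 0 < m E ->
  0 < eps -> eps <= 1 ->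
  exists N, forall n, (N <= n)%N ->
    exists2 l, (l < height n)%N & m (level n l `\` E) < eps * m (B n).
Proof.
move=> mE E0 eps0 eps1.
(* if U is this close to E, then eps * m U is more than m (U `\` E) *)
have eta0 : 0 < eps * m E / 2 by rewrite divr_gt0// mulr_gt0.
have [s [sh Us]] := tower_dense towB mE eta0.
have [N NU] := tower_union_levels sh.
exists N => n /NU; set U := \bigcup_(p in _) _ => nU.
have mU : measurable U.
  by apply: fin_bigcup_measurable => // p _; exact: measurable_level.
apply: contrapT => noL.
have sparse : eps * m U <= m (U `\` E).
  apply: (tower_union_measureD (ltW eps0) nU) => // l lh.
  by rewrite leNgt; apply/negP => lE; apply: noL; exists l.
have mY : measurable (E `+` U) by apply: measurableU; exact: measurableD.
have UY : m (U `\` E) <= m (E `+` U).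
  by apply: le_fine_prob => //; [exact: measurableD|move=> x; right].
have EY : m (E `\` U) <= m (E `+` U).
  by apply: le_fine_prob => //; [exact: measurableD|move=> x; left].
have Yeta : m (E `+` U) < eps * m E / 2 by rewrite -lte_fin prob_fineK.
have EU : m (E `&` U) <= m U.
  by apply: le_fine_prob => //; exact: measurableI.
have EE := fine_probD P mE mU.
have : eps * (m E - m U) <= 1 * m (E `\` U).
  have [EU0|EU0] := leP (m E - m U) 0.
    rewrite mul1r (le_trans _ (fine_prob_ge0 _ _))//.
    by rewrite mulr_ge0_le0// ltW.
  rewrite ler_pM//; [exact: ltW|exact: ltW|lra].
rewrite mulrBr mul1r; lra.
Qed.

Lemma level_iter n k l x : level n l x -> level n (k + l) (iter k S x).
Proof. by rewrite /level image_iterD => lx; exists x. Qed.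

Lemma sub_base n N : (N <= n)%N -> B n `<=` B N.
Proof.
move=> /subnKC <-; elim: (n - N)%N => [|k IH]; first by rewrite addn0.
rewrite addnS; apply: subset_trans IH => x Bx.
rewrite (tower_cut towB); exists 0%N; first exact: ltnW (q_gt1 _).
by rewrite offset0 image_id.
Qed.

(** Bases decrease, and by [level_nearly_inside] for the whole space the bases
of late towers cannot be null. *)
Lemma fine_base_gt0 n : 0 < m (B n).
Proof.
have T0 : 0 < m [set: X] by rewrite probability_setT.
have [N /(_ _ (leq_maxl N n))[l _]] :=
  level_nearly_inside measurableT T0 ltr01 (lexx _).
rewrite setDT measure0 mul1r => /lt_le_trans; apply.
apply: le_fine_prob; [exact: (tower_base towB)|exact: (tower_base towB)|].
by apply: sub_base; exact: leq_maxr.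
Qed.

(** The bound [M] on the numbers of cuts enters here: a level with a proportion
less than [1 / (2 M)] outside [E] is cut into at most [M] pieces of equal
measure, so each piece is more than half inside [E]. Piece [i] is the image of
the previous piece under [height n + a n i] iterations, so the parts of the two
pieces in [E] have to match at some point. *)
Lemma return_in_column E M : (forall n, (q n <= M)%N) ->
  measurable E -> 0 < m E ->
  exists N, forall n i, (N <= n)%N -> (0 < i < q n)%N ->
    exists2 x, E x & E (iter (height n + a n i) S x).
Proof.
move=> qM mE E0.
have M0 : 0 < M%:R :> R by rewrite ltr0n (leq_trans _ (qM 0%N))// ltnW.
have M1 : 1 <= M%:R :> R by rewrite ler1n -(@ltr0n R).
have eps0 : 0 < (2 * M%:R)^-1 :> R by rewrite invr_gt0 mulr_gt0.
have eps1 : (2 * M%:R)^-1 <= 1 :> R by rewrite invf_le1 ?mulr_gt0//; lra.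
have [N inside] := level_nearly_inside mE E0 eps0 eps1.
exists N => n [//|i] Nn /= iq; have [l lh lE] := inside n Nn.
have half j : (j < q n)%N ->
    m (level n.+1 (l + offset n j) `\` E) < m (B n.+1) / 2.
  move=> jq; apply: (@le_lt_trans _ _ (m (level n l `\` E))).
    apply: le_fine_prob;
      try (apply: measurableD => //; exact: measurable_level).
    by apply: setSD; exact: sub_level.
  apply: (lt_le_trans lE).
  rewrite invfM -mulrA mulrC ler_pM2r// ler_pdivrMl//.
  rewrite (le_trans (base_cut_le n))// ler_wpM2r ?fine_prob_ge0//.
  by rewrite ler_nat.
set t := (height n + a n i.+1)%N; apply: contrapT => noret.
have : m (level n.+1 (l + offset n i)) <=
    m (level n.+1 (l + offset n i) `\` E) +
    m (iter t S @^-1` (level n.+1 (l + offset n i.+1) `\` E)).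
  apply: fine_prob_leU.
  - exact: measurable_level.
  - by apply: measurableD => //; exact: measurable_level.
  - apply: measurable_iter_preimage.
    by apply: measurableD => //; exact: measurable_level.
  move=> x lx; have [Ex|nEx] := pselect (E x); [right|by left].
  split; last by move=> Etx; apply: noret; exists x.
  by rewrite offsetS addnA addnC; exact: level_iter.
rewrite (measure_level n.+1) measure_iter_preimage; last first.
  by apply: measurableD => //; exact: measurable_level.
have := half _ iq; have := half _ (ltnW iq); lra.
Qed.

(** For a common late [n], one level of tower [n] is more than half inside [E]
and one is more than half inside [E']; pulled back to the base, these two
halves overlap. *)
Lemma common_orbit E E' : measurable E -> measurable E' ->
  0 < m E -> 0 < m E' ->
  exists x l l', E (iter l S x) /\ E' (iter l' S x).
Proof.
move=> mE mE' E0 E0'.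
have half0 : 0 < 2^-1 :> R by lra.
have half1 : 2^-1 <= 1 :> R by lra.
have [N inE] := level_nearly_inside mE E0 half0 half1.
have [N' inE'] := level_nearly_inside mE' E0' half0 half1.
have [l lh lE] := inE _ (leq_maxl N N').
have [l' lh' lE'] := inE' _ (leq_maxr N N').
move: (maxn N N') => n in lh lE lh' lE' *.
apply: contrapT => noorb.
have mD k F : measurable F -> measurable (iter k S @^-1` (level n k `\` F)).
  move=> mF; apply: measurable_iter_preimage.
  by apply: measurableD => //; exact: measurable_level.
have : m (B n) <= m (iter l S @^-1` (level n l `\` E)) +
    m (iter l' S @^-1` (level n l' `\` E')).
  apply: fine_prob_leU; [exact: (tower_base towB)|exact: mD|exact: mD|].
  move=> x Bx; have [Ex|nEx] := pselect (E (iter l S x)).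
    right; split; first by exists x.
    by move=> Ex'; apply: noorb; exists x, l, l'.
  by left; split=> //; exists x.
rewrite !measure_iter_preimage;
  try (apply: measurableD => //; exact: measurable_level).
lra.
Qed.

(** * The arithmetic condition implies total ergodicity *)

Lemma measurable_cylinder A w : measurable A -> measurable (cylinder S A w).
Proof.
move=> mA; have -> : cylinder S A w =
    \bigcap_j iter j S @^-1` (if w j then A else ~` A).
  apply/seteqP; split=> x.
    by move=> wx j _ /=; rewrite -(wx j) /itinerary; case: asboolP.
  move=> wx j; have /= := wx j Logic.I; rewrite /itinerary.
  by case: (w j) => [Ax|nAx]; [exact/asboolP|exact: asboolF].
apply: bigcapT_measurable => j; apply: measurable_iter_preimage.
by case: (w j) => //; exact: measurableC.
Qed.

Lemma periodic_cylinder A k : measurable A -> (0 < k)%N ->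
  iter k S @^-1` A = A ->
  exists2 w, period w k & 0 < m (cylinder S A w).
Proof.
move=> mA k0 kA; apply: contrapT => nocyl.
pose w (s : seq bool) j := nth false s (j %% k)%N.
(* finitely many sequences occur, but a countable cover is enough *)
pose F n := if unpickle n is Some s then cylinder S A (w s) else set0.
have F0 n : P.-negligible (F n).
  rewrite /F; case: unpickle => [s|]; last exact: negligible_set0.
  apply/negligibleP; first exact: measurable_cylinder.
  apply/prob_eq0; first exact: measurable_cylinder.
  apply: contrapT => ws0; apply: nocyl; exists (w s).
    by move=> j; rewrite /w modnDr.
  by rewrite lt_neqAle fine_prob_ge0 andbT eq_sym; apply/eqP.
have T0 : P [set: X] = 0%E.
  apply: measure_negligible => //.
  apply: negligibleS (negligible_bigcup F0) => x _.
  exists (pickle (mkseq (itinerary S A x) k)) => //; rewrite /F pickleK => j.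
  rewrite /w nth_mkseq ?ltn_mod// {1}(divn_eq j k) addnC.
  exact/period_mul/itinerary_period.
by move/eqP: T0; rewrite probability_setT onee_eq0.
Qed.

(** By [height_offset], the height of tower [n.+1] is the height of tower [n]
plus a sum of the numbers [height n + a n i]. *)
Lemma height_congr n k :
  (forall i, (0 < i < q n)%N -> (k %| height n + a n i)%N) ->
  (height n.+1 = height n %[mod k])%N.
Proof.
move=> kdvd; have q0 := ltnW (q_gt1 n).
rewrite height_offset// -modnDml.
suff /eqP -> : (k %| offset n (q n).-1)%N by rewrite add0n.
rewrite /offset prednK// big_nat_cond; apply: dvdn_sum => i.
by rewrite andbT => /kdvd.
Qed.

(** The divisibility hypothesis may use the congruence that is being proved:
this covers both the case where [height n + a n i] is known to be divisible and
the case where [height N + a n i] is. *)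
Lemma height_congrE N k :
  (forall n, (N <= n)%N -> (height n = height N %[mod k])%N ->
     forall i, (0 < i < q n)%N -> (k %| height n + a n i)%N) ->
  forall n, (N <= n)%N -> (height n = height N %[mod k])%N.
Proof.
move=> kdvd n /subnKC <-; elim: (n - N)%N => [|t IH]; first by rewrite addn0.
by rewrite addnS height_congr// => i; apply: kdvd => //; exact: leq_addr.
Qed.

Lemma dvdn_height N n k i : (height n = height N %[mod k])%N ->
  (k %| height n + a n i)%N = (k %| height N + a n i)%N.
Proof. by move=> e; rewrite /dvdn -modnDml e modnDml. Qed.

Lemma ergodic_iter M : (forall n, (q n <= M)%N) ->
  (forall k N, (1 < k)%N -> exists n i : nat,
     [/\ (N <= n)%N, (0 < i < q n)%N & ~~ (k %| height N + a n i)%N]) ->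
  forall k, (0 < k)%N -> ergodic P (iter k S).
Proof.
move=> qM spread k k0 A mA kA.
have [w wk w0] := periodic_cylinder mA k0 kA.
have mw := measurable_cylinder w mA.
have [e [e0 we edvd]] := least_period k0 wk.
have [e1|e1] := ltnP 1 e.
  have [N retN] := return_in_column qM mw w0.
  have dvde n : (N <= n)%N -> (height n = height N %[mod e])%N ->
      forall i, (0 < i < q n)%N -> (e %| height n + a n i)%N.
    move=> Nn _ i iq; have [x wx wrx] := retN n i Nn iq.
    exact: edvd (return_period wx wrx).
  have [n [i [Nn iq]]] := spread e N e1.
  have hn := height_congrE dvde Nn.
  by rewrite -(dvdn_height i hn) dvde.
have {e e0 we edvd e1} wcst j : w j = w 0%N.
  have e_eq1 : e = 1%N by apply/eqP; rewrite eqn_leq e1.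
  by rewrite -(period_mul j we 0%N) add0n e_eq1 muln1.
(* A' is the side of A that points with itinerary w never visit *)
pose A' := if w 0%N then ~` A else A.
have mA' : measurable A' by rewrite /A'; case: ifP => // _; exact: measurableC.
have A'0 : P A' = 0%E.
  apply/prob_eq0 => //; apply: contrapT => A'0.
  have {}A'0 : 0 < m A'.
    by rewrite lt_neqAle fine_prob_ge0 andbT eq_sym; apply/eqP.
  have [x [l [l' [wx]]]] := common_orbit mw mA' w0 A'0.
  have : itinerary S A x l' = w 0%N.
    (* move forward by l periods to reach the orbit of iter l S x *)
    rewrite -(period_mul l (itinerary_period x kA)).
    have -> : (l' + l * k = l' + l * k.-1 + l)%N.
      by rewrite -addnA -mulnSr prednK.
    by rewrite -itinerary_iter wx.
  by rewrite /itinerary /A'; case: (w 0%N); case: asboolP.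
move: A'0; rewrite /A'; case: (w 0%N) => A'0; last by left.
right; move: A'0; rewrite probability_setC// -(prob_fineK P mA) -EFinB => -[].
by move=> A'0; congr EFin; lra.
Qed.

(** * Total ergodicity implies the arithmetic condition *)

(** Every offset is a sum of numbers [height n + a n j], hence a multiple of
[k]. *)
Lemma base_levels N k :
  (forall n i, (N <= n)%N -> (0 < i < q n)%N -> (k %| height N + a n i)%N) ->
  forall n x, (N <= n)%N -> B N x ->
  exists p, [/\ (p < height n)%N, (k %| p)%N & level n p x].
Proof.
move=> kdvd; have hN : forall n, (N <= n)%N -> (height n = height N %[mod k])%N.
  by apply: height_congrE => n Nn hn i iq; rewrite (dvdn_height i hn) kdvd.
move=> n x /subnKC <- Bx; elim: (n - N)%N => [|t [p [ph kp]]].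
  by exists 0%N; rewrite addn0 height_gt0// dvdn0 /level image_id.
rewrite level_cut addnS => -[i /= iq px].
exists (p + offset (N + t) i)%N; split=> //; first exact: offset_level.
rewrite dvdn_addr// /offset big_nat_cond; apply: dvdn_sum => j.
rewrite andbT ltnS => /andP[j0 ji].
rewrite (dvdn_height _ (hN _ (leq_addr _ _))) kdvd ?leq_addr// j0.
exact: leq_ltn_trans iq.
Qed.

(** A point of [B N] that returns at time [t] without leaving tower [n] moves
between two levels whose heights are multiples of [k]. A return at another time
therefore starts in one of the top [t] levels of tower [n], for every [n >= N],
and these have small total measure. *)
Lemma base_return_null N k t :
  (forall n i, (N <= n)%N -> (0 < i < q n)%N -> (k %| height N + a n i)%N) ->
  ~~ (k %| t)%N -> P (B N `&` iter t S @^-1` B N) = 0%E.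
Proof.
move=> kdvd kt; set F := _ `&` _.
have mB := tower_base towB.
have mF : measurable F.
  by apply: measurableI => //; exact: measurable_iter_preimage.
have Fle n : (N <= n)%N -> m F <= t%:R * m (B n).
  move=> Nn; apply: (@fine_prob_sub_bigcup _ _ _ P _
      (fun s => level n (height n - s.+1)%N)) => //.
  - by move=> s; exact: measurable_level.
  - by move=> s; rewrite measure_level.
  move=> x [Bx Btx]; have [p [ph kp px]] := base_levels kdvd Nn Bx.
  have [p' [p'h kp' p'x]] := base_levels kdvd Nn Btx.
  exists (height n - p.+1)%N => /=; last by rewrite subnSK// subKn// ltnW.
  rewrite ltnNge; apply: contra kt => tp.
  have tph : (t + p < height n)%N by rewrite addnC -addSn -leq_subRL.
  have := level_inj tph p'h (level_iter t px) p'x => e.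
  by rewrite -(dvdn_addl _ kp) e.
apply/prob_eq0 => //; apply/eqP; rewrite eq_le fine_prob_ge0 andbT.
rewrite leNgt; apply/negP => F0.
have tF0 : 0 <= t%:R / m F by rewrite divr_ge0// ltW.
(* as n < height n, the base has measure at most 1 / n, so m F <= t / n; the
   Archimedean property gives an n that contradicts this *)
pose n := maxn N (Num.bound (t%:R / m F)).
have Nn : (N <= n)%N by exact: leq_maxl.
have nt : t%:R < n%:R * m F.
  rewrite -ltr_pdivrMr// (lt_le_trans (archi_boundP tF0))// ler_nat.
  exact: leq_maxr.
have hn : n%:R * m (B n) <= 1.
  apply: le_trans (height_base_le1 n); rewrite ler_wpM2r ?fine_prob_ge0//.
  by rewrite ler_nat ltnW// ltn_height.
have : n%:R * m F <= t%:R * (n%:R * m (B n)).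
  by rewrite mulrCA ler_wpM2l// Fle.
have : t%:R * (n%:R * m (B n)) <= t%:R by rewrite ler_piMr.
lra.
Qed.

(** The set [E] below contains its preimage under the [k]-th iterate, which has
the same measure, so it is invariant modulo null sets. *)
Lemma not_ergodic_iter N k : (1 < k)%N ->
  (forall n i, (N <= n)%N -> (0 < i < q n)%N -> (k %| height N + a n i)%N) ->
  ~ ergodic_mod0 P (iter k S).
Proof.
move=> k1 kdvd ergk.
have mB := tower_base towB N.
pose F i := iter (i * k) S @^-1` B N.
have mF i : measurable (F i) by exact: measurable_iter_preimage.
pose E := \bigcup_i F i.
have mE : measurable E by exact: bigcupT_measurable.
have mkE : measurable (iter k S @^-1` E) by exact: measurable_iter_preimage.
have kEE : iter k S @^-1` E `<=` E.
  by move=> x [i _ Fi]; exists i.+1 => //; rewrite /F mulSn addnC /= iterD.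
have EkE : P (E `+` iter k S @^-1` E) = 0%E.
  apply/prob_eq0; first by apply: measurableU; exact: measurableD.
  rewrite /setY [X in _ `|` X](_ : _ = set0) ?setU0; last first.
    by apply/seteqP; split=> // x [/kEE].
  have := fine_probD P mE mkE; rewrite setIidr// measure_iter_preimage//; lra.
have BE : B N `<=` E by move=> x Bx; exists 0%N.
have B0 := fine_base_gt0 N.
have PE : P E = 1%E.
  have [E0|//] := ergk _ mE EkE.
  by have := le_fine_prob P mB mE BE; rewrite E0 /= leNgt B0.
have mSE : measurable (iter 1 S @^-1` E) by exact: measurable_iter_preimage.
have BSE : P (B N `&` iter 1 S @^-1` E) = 0%E.
  apply/negligibleP; first exact: measurableI.
  have -> : B N `&` iter 1 S @^-1` E =
      \bigcup_i (B N `&` iter (i * k + 1) S @^-1` B N).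
    rewrite -setI_bigcupr; congr (_ `&` _); rewrite preimage_bigcup.
    by apply: eq_bigcupr => i _; apply/seteqP; split=> x; rewrite /F/= iterD.
  apply: negligible_bigcup => i.
  apply/negligibleP.
    by apply: measurableI => //; exact: measurable_iter_preimage.
  apply: base_return_null kdvd _; rewrite dvdn_addr ?dvdn_mull// dvdn1.
  by rewrite gtn_eqF.
have SE0 : m (~` (iter 1 S @^-1` E)) = 0.
  apply/prob_eq0; first exact: measurableC.
  by rewrite probability_setC// measure_iter_preimage// PE subee.
have {ergk EkE PE} := fine_probD P mB mSE; rewrite BSE setDE /= {BSE}.
have : m (B N `&` ~` (iter 1 S @^-1` E)) <= m (~` (iter 1 S @^-1` E)).
  apply: le_fine_prob => //; [|exact: measurableC].
  by apply: measurableI => //; exact: measurableC.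
rewrite SE0/=; lra.
Qed.

(** * The criterion for towers *)

Theorem ergodic_iterP M : (forall n, (q n <= M)%N) ->
  (forall k, (0 < k)%N -> ergodic P (iter k S)) <->
  (forall k, (1 < k)%N -> forall N, exists n i : nat,
     [/\ (N <= n)%N, (0 < i < q n)%N & ~~ (k %| height N + a n i)%N]).
Proof.
move=> qM; split=> [ergS k k1 N|spread]; last first.
  by apply: (ergodic_iter qM) => k N k1; exact: spread.
apply: contrapT => noret; apply: (@not_ergodic_iter N k k1).
  move=> n i Nn iq; apply: contrapT => /negP kni; apply: noret.
  by exists n, i; split.
apply/ergodic_mod0P => [A|A|].
- exact: measurable_iter_preimage.
- exact: measure_iter_preimage.
- by apply: ergS; exact: ltnW.
Qed.

End cutting_and_stacking.

(** * Invariance under isomorphism *)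

Section isomorphisms.
Context {d d' : measure_display} {X : measurableType d} {Y : measurableType d'}
  {R : realType}.
Implicit Types (P : probability X R) (Q : probability Y R).

Lemma set_fun_iter T (U : set T) (f : T -> T) k :
  set_fun U U f -> set_fun U U (iter k f).
Proof. by move=> fU; elim: k => // k IH x /IH/fU. Qed.

Lemma isomorphic_iter P T Q S k :
  isomorphic P setT T Q setT S ->
  isomorphic P setT (iter k T) Q setT (iter k S).
Proof.
move=> [X0 [Y0 [phi [[X0T X0n TX] [Y0T Y0n SY] phib phim phiT]]]].
exists X0, Y0, phi; split=> //.
- by split=> //; exact: set_fun_iter.
- by split=> //; exact: set_fun_iter.
- move=> x X0x; elim: k => //= k IH.
  by rewrite -IH phiT//; exact: (set_fun_iter k TX).
Qed.

Lemma isomorphic_sym P T Q S :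
  isomorphic P setT T Q setT S -> isomorphic Q setT S P setT T.
Proof.
move=> [X0 [Y0 [phi [[X0T X0n TX] [Y0T Y0n SY] phib phim phiT]]]].
have [phiXY phii phis] := phib.
pose psi y := xget point [set x | X0 x /\ phi x = y].
have psiP y : Y0 y -> X0 (psi y) /\ phi (psi y) = y.
  by move=> /phis[x X0x xy]; rewrite /psi; case: xgetP => [z -> []//|/(_ x)[]].
have psiK x : X0 x -> psi (phi x) = x.
  move=> X0x; have [X0p pp] := psiP _ (phiXY _ X0x).
  by apply: phii => //; rewrite inE.
exists Y0, X0, psi; split=> //.
- split.
  + by move=> y /psiP[].
  + move=> y y'; rewrite !inE => /psiP[_ {2}<-] /psiP[_ {2}<-] e; by rewrite e.
  + by move=> x X0x; exists (phi x); [exact: phiXY|exact: psiK].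
- move=> A m AY; have AE : phi @` (psi @` A) = A.
    apply/seteqP; split=> [y [_ [z Az <-] <-]|y Ay].
      by have [_ ->] := psiP _ (AY _ Az).
    by exists (psi y); [exists y|have [_ ->] := psiP _ (AY _ Ay)].
  rewrite -{1}AE; apply: iff_sym; apply: phim => _ [y Ay <-].
  by have [] := psiP _ (AY _ Ay).
- move=> y Y0y; have [X0p pp] := psiP _ Y0y.
  by rewrite -{1}pp -phiT// psiK//; exact: TX.
Qed.

(** The image of [A] agrees with a measurable set [D] up to a null set. Off the
exceptional null sets, membership in [D] is membership in [A] of the
corresponding point, so [D] inherits invariance modulo null sets. *)
Lemma isomorphic_ergodic_mod0 P T Q S :
  (forall A, measurable A -> measurable (T @^-1` A)) ->
  (forall A, measurable A -> measurable (S @^-1` A)) ->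
  (forall A, measurable A -> Q (S @^-1` A) = Q A) ->
  isomorphic P setT T Q setT S -> ergodic_mod0 Q S -> ergodic_mod0 P T.
Proof.
move=> mT mS pS [X0 [Y0 [phi [[_ X0n TX] [_ Y0n SY] phib phim phiT]]]] ergS.
have [phiXY phii phis] := phib.
move=> A mA TA0; pose C := phi @` (A `&` X0).
have [D [mD CD QD]] : has_completed_measure Q C (P A).
  apply/phim; first by move=> x [].
  exists A; split=> //; apply: negligibleS X0n => x [[[]//]|[Ax nAx]].
  by split=> // X0x; apply: nAx.
pose Z := phi @` ((A `+` T @^-1` A) `&` X0).
have Zn : Q.-negligible Z.
  have [D' [mD' ZD' QD']] : has_completed_measure Q Z 0%E.
    apply/phim; first by move=> x [].
    exists set0; split; rewrite ?measure0// setY0.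
    have TAn : P.-negligible (A `+` T @^-1` A).
      apply/negligibleP => //.
      by apply: measurableU; apply: measurableD => //; exact: mT.
    by apply: negligibleS TAn => x [].
  have D'n : Q.-negligible D' by apply/negligibleP.
  apply: negligibleS (negligibleU ZD' D'n) => y Zy.
  by have [D'y|nD'y] := pselect (D' y); [right|left; left].
rewrite -QD; apply: ergS => //; apply/negligibleP.
  by apply: measurableU; apply: measurableD => //; exact: mS.
have SCDn : Q.-negligible (S @^-1` (C `+` D)) by exact: negligible_preimage.
apply: negligibleS
  (negligibleU (negligibleU CD SCDn) (negligibleU Zn Y0n)) => y Dy.
apply: contrapT => /not_orP[/not_orP[nCD nSCD] /not_orP[nZ nY0]].
have Y0y : Y0 y by apply: contrapT => ?; apply: nY0.
have [x X0x xy] := phis _ Y0y.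
have CE z : X0 z -> C (phi z) <-> A z.
  move=> X0z; split=> [[z' [Az' X0z'] zz']|Az]; last by exists z.
  by rewrite -(phii z' z)// inE.
have nsym U V z : ~ (U `+` V) z -> U z <-> V z.
  move=> nUV; split=> h; apply: contrapT => h'; apply: nUV; [by left|by right].
have CDy := nsym _ C D y nCD; have CDSy := nsym _ C D (S y) nSCD.
have AT : A x <-> A (T x).
  by apply: (nsym _ A (T @^-1` A)) => AT; apply: nZ; exists x.
have Cy := CE _ X0x; have CSy := CE _ (TX _ X0x).
rewrite phiT// xy in CSy; rewrite xy in Cy.
have DS : D y <-> D (S y) by tauto.
by case: Dy => -[h nh]; apply: nh; apply/DS.
Qed.

End isomorphisms.

Lemma isomorphic_ergodic_iter {d d' : measure_display} {X : measurableType d}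
    {Y : measurableType d'} {R : realType}
    (P : probability X R) T (Q : probability Y R) S k :
  measure_preserving P setT T -> measure_preserving Q setT S ->
  isomorphic P setT T Q setT S ->
  ergodic P (iter k T) <-> ergodic Q (iter k S).
Proof.
move=> [_ pT] [_ pS] TS; have TSk := isomorphic_iter k TS.
have mT A : measurable A -> measurable (T @^-1` A).
  by move=> mA; have [] := pT A mA (@subsetT _ A); rewrite setTI.
have eT A : measurable A -> P (T @^-1` A) = P A.
  by move=> mA; have [] := pT A mA (@subsetT _ A); rewrite setTI.
have mS A : measurable A -> measurable (S @^-1` A).
  by move=> mA; have [] := pS A mA (@subsetT _ A); rewrite setTI.
have eS A : measurable A -> Q (S @^-1` A) = Q A.
  by move=> mA; have [] := pS A mA (@subsetT _ A); rewrite setTI.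
have mTk := measurable_preimage_iter mT k.
have eTk := measure_preimage_iter mT eT k.
have mSk := measurable_preimage_iter mS k.
have eSk := measure_preimage_iter mS eS k.
apply: (iff_trans (ergodic_mod0P mTk eTk)).
apply: (iff_trans _ (iff_sym (ergodic_mod0P mSk eSk))); split.
  exact: isomorphic_ergodic_mod0 mSk mTk eTk (isomorphic_sym TSk).
exact: isomorphic_ergodic_mod0 mTk mSk eSk TSk.
Qed.

(** * From a carrier set to a probability space *)

Section restriction.
Context {d : measure_display} {X : measurableType d} {R : realType}.
Variables (mu : {measure set X -> \bar R}) (D : set X).
Hypotheses (mD : measurable D) (muD : mu D = 1%E).

Lemma restricted_probability :
  exists P : probability X R, forall A, P A = mu (A `&` D).
Proof.
pose r : {measure set X -> \bar R} := mrestr mu mD.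
have rT : r setT = 1%E by rewrite /= /mrestr setTI.
pose B := Measure_isProbability.Build _ _ _ r rT.
pose P : probability X R := HB.pack (Measure.sort r) B.
by exists P.
Qed.

Variables (P : probability X R) (S : X -> X).
Hypothesis PE : forall A, P A = mu (A `&` D).

(** A map of [D] has arbitrary values off [D]; making it the identity there
keeps it injective, measurable and measure preserving on the whole space. *)
Definition extend_id x := if x \in D then S x else x.

Lemma extend_idE x : D x -> extend_id x = S x.
Proof. by move=> Dx; rewrite /extend_id mem_set. Qed.

Lemma extend_idN x : ~ D x -> extend_id x = x.
Proof. by move=> Dx; rewrite /extend_id memNset. Qed.

Hypothesis SD : set_fun D D S.

Lemma iter_extend_idE k x : D x -> iter k extend_id x = iter k S x.
Proof.
move=> Dx; elim: k => //= k ->; rewrite extend_idE//.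
exact: set_fun_iter SD _ Dx.
Qed.

Lemma image_iter_extend_id k A : A `<=` D ->
  iter k extend_id @` A = iter k S @` A.
Proof. by move=> AD; apply: eq_imagel => x /AD; exact: iter_extend_idE. Qed.

Lemma extend_id_automorphism :
  invertible_measure_preserving mu D S -> automorphism P extend_id.
Proof.
move=> [[_ Si _] [_ Sp] Sm].
have preE A : extend_id @^-1` A =
    (D `&` S @^-1` (A `&` D)) `|` (A `\` D).
  apply/seteqP; split=> [x /= Ax|x [[Dx [Ax _]]|[Ax nDx]] /=].
  - have [Dx|nDx] := pselect (D x).
      by left; rewrite extend_idE// in Ax; split=> //; split=> //; exact: SD.
    by right; rewrite extend_idN// in Ax.
  - by rewrite extend_idE.
  - by rewrite extend_idN.
have mpre A : measurable A -> measurable (extend_id @^-1` A).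
  move=> mA; rewrite preE; apply: measurableU; last exact: measurableD.
  by apply: (Sp _ _ _).1; [exact: measurableI|exact: subIsetr].
split=> //.
- move=> x y; have [Dx|nDx] := pselect (D x); have [Dy|nDy] := pselect (D y).
  + by rewrite !extend_idE// => /Si; apply; rewrite inE.
  + rewrite extend_idE// extend_idN// => xy.
    by case: nDy; rewrite -xy; exact: SD.
  + rewrite extend_idN// extend_idE// => xy.
    by case: nDx; rewrite xy; exact: SD.
  + by rewrite !extend_idN.
- move=> A mA; have -> : extend_id @` A = S @` (A `&` D) `|` (A `\` D).
    apply/seteqP; split=> [_ [x Ax <-]|y [[x [Ax Dx] <-]|[Ay nDy]]].
    + have [Dx|nDx] := pselect (D x).
        by left; rewrite extend_idE//; exists x.
      by right; rewrite extend_idN.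
    + by exists x => //; rewrite extend_idE.
    + by exists y => //; rewrite extend_idN.
  apply: measurableU; last exact: measurableD.
  by apply: Sm; [exact: measurableI|exact: subIsetr].
- move=> A mA; rewrite !PE preE.
  rewrite (_ : (_ `|` _) `&` D = D `&` S @^-1` (A `&` D)); last first.
    apply/seteqP; split=> x; first by case=> -[//|[_ nDx] /nDx].
    by move=> Ax; split; [left|case: Ax].
  by apply: (Sp _ _ _).2; [exact: measurableI|exact: subIsetr].
Qed.

Lemma negligible_restrict N : mu.-negligible (D `&` N) <-> P.-negligible N.
Proof.
split=> [[M [mM M0 NM]]|[M [mM M0 NM]]].
  exists (M `|` ~` D); split.
  - by apply: measurableU => //; exact: measurableC.
  - rewrite PE setIUl setICl setU0.
    apply: (@subset_measure0 _ _ _ _ _ M) => //; exact: measurableI.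
  - move=> x Nx; have [Dx|nDx] := pselect (D x); last by right.
    by left; apply: NM.
exists (M `&` D); split; first exact: measurableI.
  by rewrite -PE.
by move=> x [Dx /NM].
Qed.

Lemma has_completed_measure_restrict A m : A `<=` D ->
  has_completed_measure mu A m <-> has_completed_measure P A m.
Proof.
move=> AD; split=> -[B [mB AB Bm]]; last first.
  exists (B `&` D); split; [exact: measurableI| |by rewrite -PE].
  apply: negligibleS ((negligible_restrict _).2 AB) => x.
  case=> [[Ax nBD]|[[Bx Dx] nAx]]; split=> //; [exact: AD| |by right].
  by left; split=> // Bx; apply: nBD; split=> //; exact: AD.
exists B; split=> //.
  apply/negligible_restrict.
  exact: negligibleS AB => x [].
have BD0 : mu (B `\` D) = 0%E.
  apply/negligibleP; first exact: measurableD.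
  by apply: negligibleS AB => x [Bx nDx]; right; split=> // /AD.
have BDI : mu B = (mu (B `\` D) + mu (B `&` D))%E by exact: measureDI.
by rewrite PE -Bm BDI BD0 add0e.
Qed.

Lemma isomorphic_restrict (d' : measure_display) (Y : measurableType d')
    (Q : probability Y R) (T : Y -> Y) :
  isomorphic Q setT T mu D S -> isomorphic Q setT T P setT extend_id.
Proof.
move=> [X0 [Y0 [phi [[X0T X0n TX] [Y0D Y0n SY] phib phim phiT]]]].
have [phiXY _ _] := phib.
exists X0, Y0, phi; split=> //.
- split=> //; first by apply/negligible_restrict; rewrite setTD -setDE.
  by move=> y Y0y; rewrite extend_idE; [exact: SY|exact: Y0D].
- move=> A m AX0; apply: (iff_trans (phim A m AX0)).
  by apply: has_completed_measure_restrict => _ [x /AX0/phiXY/Y0D + <-].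
- by move=> x X0x; rewrite extend_idE; [exact: phiT|exact/Y0D/phiXY].
Qed.

(** The subbase of column [i], shifted up by the height of the tower and by the
[a n i.+1] spacers above it, is the next subbase. *)
Lemma rank_one_sets_offset q a B Bs C : rank_one_sets q a mu D S B Bs C ->
  forall n i, (i < q n)%N ->
    Bs n i.+1 = iter (offset q a n i) S @` B n.+1.
Proof.
move=> RS n; elim=> [_|i IH iq].
  by rewrite offset0 image_id (next_base RS).
have i1q : (0 < i.+1 < q n)%N by [].
rewrite offsetS addnC image_iterD -IH ?(ltnW iq)//.
have [a0|a0] := eqVneq (a n i.+1) 0%N.
  by rewrite a0 addn0 (column_to_column RS i1q a0).
have spacers j : (j < a n i.+1)%N ->
    C n i.+1 j.+1 = iter (j + height q a n) S @` Bs n i.+1.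
  elim: j => [|j IHj] ja.
    by rewrite (column_to_spacer RS i1q)//; exact/eqP.
  rewrite -(spacer_to_spacer RS i1q)// (IHj (ltnW ja)).
  by rewrite -(image_iterD S 1).
rewrite -(spacer_to_column RS i1q); last exact/eqP.
have a_gt0 : (0 < a n i.+1)%N by rewrite lt0n.
have := spacers (a n i.+1).-1; rewrite prednK// => ->//.
by rewrite -(image_iterD S 1) addnA add1n prednK// addnC.
Qed.

Lemma rank_one_sets_towers q a B Bs C :
  rank_one_sets q a mu D S B Bs C -> towers P extend_id q a B.
Proof.
move=> RS; have BD n : B n `<=` D by have [] := base_meas RS n.
have imB k n : iter k extend_id @` B n = iter k S @` B n.
  exact: image_iter_extend_id.
split=> [n|n|n i j|A e mA e0].
- by have [] := base_meas RS n.
- have [<- _ _] := subbase_partition RS n.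
  apply/seteqP; split=> x.
    move=> [[//|i] /= iq Bi]; exists i => //.
    by rewrite imB -(rank_one_sets_offset RS).
  move=> [i /= iq xi]; exists i.+1 => //=.
  by rewrite (rank_one_sets_offset RS)// -imB.
- by rewrite !imB; exact: (levels_disjoint RS).
- have [s [sh sA]] :=
    levels_dense RS (measurableI _ _ mA mD) (@subIsetr _ A D) e0.
  exists s; split=> //.
  under eq_bigcupr do rewrite imB.
  rewrite PE; set U := \bigcup_(p in _) _ in sA *.
  have UD : U `<=` D.
    by move=> _ [p _ [x /BD Dx <-]]; exact: set_fun_iter SD _ Dx.
  rewrite (_ : _ `&` D = A `&` D `+` U)//.
  apply/seteqP; split=> x.
    by move=> [[[Ax nUx]|[Ux nAx]] Dx]; [left|right]; split=> // -[].
  move=> [[[Ax Dx] nUx]|[Ux nAx]]; first by split=> //; left.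
  by split; [right; split=> // Ax; apply: nAx; split=> //; exact: UD|exact: UD].
Qed.

End restriction.

(** * Rank-one transformations *)

Lemma completed_lebesgue_unit (R : realType) :
  measurable (`[0, 1] : set (caratheodory_type
     (mu_ext (wlength (@idfun R) : set (ocitv_type R) -> \bar R)))) /\
  @completed_lebesgue_measure R (`[0, 1] : set R) = 1%E.
Proof.
split.
  by apply: sub_caratheodory; exact: measurable_itv.
have -> : @completed_lebesgue_measure R (`[0, 1] : set R) =
  lebesgue_measure (`[0, 1] : set R) by [].
by rewrite lebesgue_measure_itv/= lte_fin ltr01 oppr0 adde0.
Qed.

Theorem theorem1p3 (R : realType) (d : measure_display) (X : measurableType d)
    (P : probability X R) (T : X -> X)
    (q : nat -> nat) (a : nat -> nat -> nat)
    (hT : rank_one q a P T)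
    (hq : exists M : nat, forall n, (q n <= M)%N) :
  totally_ergodic P T <->
  (forall k : nat, (1 < k)%N -> forall N : nat,
     exists n i : nat,
       [/\ (N <= n)%N, (0 < i < q n)%N & ~~ (k %| height q a N + a n i)%N]).
Proof.
have [mpT [S [[q1 invS _ [B [Bs [C RS]]]] TS]]] := hT; have [M qM] := hq.
have [mD muD] := completed_lebesgue_unit R.
have [Q QE] := restricted_probability mD muD.
have [_ [SD _] _] := invS.
have autS := extend_id_automorphism mD QE SD invS.
have towS := rank_one_sets_towers mD QE SD RS.
have TS' := isomorphic_restrict mD QE TS.
have mpS : measure_preserving Q setT (extend_id (`[0, 1] : set R) S).
  split=> // A mA _; rewrite setTI; split; first exact: aut_preimage autS A mA.
  exact: aut_measure autS A mA.
apply: (iff_trans _ (ergodic_iterP q1 autS towS qM)).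
split=> ergT k k0; apply/(isomorphic_ergodic_iter k mpT mpS TS').
  exact: ergT.
exact: ergT.
Qed.
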